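(* Let $\mathcal X=G\cap Q$, $\mathcal X_1=G\cap Q_1$, $\mathcal X_0=G\cap Q_0$ be the intersections of two quadrics in $\mathbf P^5$ defined in the context. (a) $\mathcal X$ is singular if and only if $\prod_{i=1}^3c_id_i=0$. (b) $\mathcal X_1$ is singular if and only if $c_1d_1=0$ or $b_2b_4c_2+b_1b_4c_3+b_1b_3d_2+b_2b_3d_3=0$. (c) $\mathcal X_0$ is singular if and only if $$c_1(b_1b_8+b_4b_6)(b_2b_6+b_3b_8)+c_3(b_1b_5+b_4b_7)(b_1b_8+b_4b_6)+d_1(b_1b_5+b_4b_7)(b_2b_7+b_3b_5)+d_3(b_2b_6+b_3b_8)(b_2b_7+b_3b_5)=0.$$
   Context: $k$ is an algebraically closed field of characteristic $2$. $\mathbf P^5$ has homogeneous coordinates $(X_1,X_2,X_3,Y_1,Y_2,Y_3)$. Let $G=\{\sum_{i=1}^3X_iY_i=0\}$. Three kinds of second quadrics are considered, with all constants in $k$: (a) $Q:\ \sum_{i=1}^3(a_iX_iY_i+c_iX_i^2+d_iY_i^2)=0$ with $a_1,a_2,a_3$ pairwise distinct; (b) $Q_1:\ \sum_{i=1}^3(a_iX_iY_i+c_iX_i^2+d_iY_i^2)+b_1X_2Y_3+b_2X_3Y_2+b_3X_2X_3+b_4Y_2Y_3=0$ with $a_1\neq a_2=a_3$; (c) $Q_0:\ \sum_{i=1}^3(aX_iY_i+c_iX_i^2+d_iY_i^2)+b_1X_2Y_3+b_2X_3Y_2+b_3X_2X_3+b_4Y_2Y_3+b_5X_1Y_2+b_6X_2Y_1+b_7X_1X_2+b_8Y_1Y_2=0$.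 In (b) and (c) there are $\alpha_i,\beta_i,\gamma_i,\delta_i\in k$ $(i=1,2,3)$ with $\alpha_i\delta_i+\beta_i\gamma_i=1$ such that $b_1=\beta_3\gamma_2$, $b_2=\alpha_2\delta_3$, $b_3=\gamma_2\delta_3$, $b_4=\alpha_2\beta_3$ and (in case (c)) $b_5=\beta_2\gamma_1$, $b_6=\alpha_1\delta_2$, $b_7=\gamma_1\delta_2$, $b_8=\alpha_1\beta_2$. In particular $b_1b_2=b_3b_4$ and $b_5b_6=b_7b_8$. *)

(* Defs.v *)
From HB Require Import structures.
From mathcomp Require Import all_boot all_order all_algebra.
From mathcomp Require Import mpoly.

Set Implicit Arguments.
Unset Strict Implicit.
Unset Printing Implicit Defensive.

Import GRing.Theory.
Local Open Scope ring_scope.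

Section JacobianCriterion.
Variables (k : fieldType) (n r : nat).
Implicit Types (F : r.-tuple {mpoly k[n]}) (x : 'rV[k]_n).

Definition jacobian F x : 'M[k]_(r, n) :=
  \matrix_(i < r, j < n) ((tnth F i)^`M(j)).@[x 0].

(* Points of P^(n-1) are represented by nonzero vectors of homogeneous         *)
(* coordinates.  F is meant to consist of r forms cutting out a complete       *)
(* intersection, of codimension r, taken with its scheme structure; a point of *)
(* it is singular when the Jacobian matrix has rank less than this             *)
(* codimension.  Over an algebraically closed field the closed points suffice. *)
(* Two quadrics, one irreducible and the other not a scalar multiple of it,    *)
(* intersect completely, in codimension 2.  This is the case for G and each of *)
(* Q (a not constant), Q1 (same), Q0 (some b_j nonzero) below.                 *)
Definition singular_point F x : Prop :=
  [/\ x != 0, forall i : 'I_r, (tnth F i).@[x 0] = 0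
    & (\rank (jacobian F x) < r)%N].

Definition singular F : Prop := exists x, singular_point F x.

End JacobianCriterion.

Definition i1 : 'I_3 := @Ordinal 3 0 isT.
Definition i2 : 'I_3 := @Ordinal 3 1 isT.
Definition i3 : 'I_3 := @Ordinal 3 2 isT.

Section Quadrics.
Variable k : fieldType.
Implicit Types (a c d : 'I_3 -> k).

(* The coordinates of P^5 are ordered X_1, X_2, X_3, Y_1, Y_2, Y_3. *)
Definition X (i : 'I_3) : {mpoly k[3 + 3]} := 'X_(lshift 3 i).
Definition Y (i : 'I_3) : {mpoly k[3 + 3]} := 'X_(rshift 3 i).

Definition G : {mpoly k[3 + 3]} := \sum_(i < 3) X i * Y i.

Definition Q a c d : {mpoly k[3 + 3]} :=
  \sum_(i < 3) (a i *: (X i * Y i) + c i *: X i ^+ 2 + d i *: Y i ^+ 2).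

Definition Q1 a c d (b1 b2 b3 b4 : k) : {mpoly k[3 + 3]} :=
  Q a c d + b1 *: (X i2 * Y i3) + b2 *: (X i3 * Y i2)
          + b3 *: (X i2 * X i3) + b4 *: (Y i2 * Y i3).

Definition Q0 (a : k) c d (b1 b2 b3 b4 b5 b6 b7 b8 : k) : {mpoly k[3 + 3]} :=
  Q1 (fun=> a) c d b1 b2 b3 b4
          + b5 *: (X i1 * Y i2) + b6 *: (X i2 * Y i1)
          + b7 *: (X i1 * X i2) + b8 *: (Y i1 * Y i2).

End Quadrics.

Arguments G {k}.

(* Main.v *)
Require Import Defs.
From HB Require Import structures.
From mathcomp Require Import all_boot all_order all_algebra.
From mathcomp Require Import mpoly ring.

Set Implicit Arguments.
Unset Strict Implicit.
Unset Printing Implicit Defensive.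

Import GRing.Theory.
Local Open Scope ring_scope.

(* The gradient of G vanishes only at the origin, so a point (x, y) of the
   intersection is singular iff the gradient of the second quadric is l times
   that of G there.  In characteristic 2 the squares do not contribute to the
   gradient, so this is an eigenvalue problem not involving the c_i and d_i.
   If the a_i are distinct, an eigenvector is supported on a single pair
   (x_i, y_i), and x_i y_i = 0.  Otherwise put p_i = ga_i x_i - al_i y_i and
   q_i = de_i x_i + be_i y_i.  In case (c) the equations become
     (a - l) (p_1, p_2, p_3) = - (0, p_1, p_2),
     (a - l) (q_1, q_2, q_3) = - (q_2, q_3, 0),
   so that l = a and only q_1 = s and p_3 = t can be nonzero; case (b) is the
   same with the indices 2, 3 only, next to an eigenvector on (x_1, y_1).  In
   terms of s and t both quadrics are linear in s^2 and t^2, so a common zero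
   exists iff a 2 x 2 determinant vanishes. *)

(** * Three indices and the rank of a two-row matrix *)

Lemma ord3P (P : 'I_3 -> Prop) : P i1 -> P i2 -> P i3 -> forall i, P i.
Proof.
move=> P1 P2 P3 [[|[|[|//]]] lt_i3].
- by rewrite (_ : Ordinal _ = i1) //; apply: val_inj.
- by rewrite (_ : Ordinal _ = i2) //; apply: val_inj.
- by rewrite (_ : Ordinal _ = i3) //; apply: val_inj.
Qed.

Lemma sum_ord3 (V : nmodType) (F : 'I_3 -> V) :
  \sum_(i < 3) F i = F i1 + F i2 + F i3.
Proof.
rewrite !big_ord_recr big_ord0 /= add0r.
by congr (F _ + F _ + F _); apply: val_inj.
Qed.

(** A nonzero first row already has rank 1, so the rank stays below 2 exactly when the whole row
    space is the line it spans. *)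
Lemma rank_col_lt2 (k : fieldType) n (J : 'M[k]_(2, n)) :
  row 0 J != 0 ->
  (\rank J < 2)%N <-> exists l, row 1 J = l *: row 0 J.
Proof.
move=> J0; have rJ0 : \rank (row 0 J) = 1%N by rewrite rank_rV J0.
split=> [rJ | [l J1]].
  have : (J <= row 0 J)%MS.
    by rewrite -(mxrank_leqif_sup (row_sub 0 J)) eqn_leq mxrankS ?row_sub ?rJ0.
  by move=> /(submx_trans (row_sub 1 J)) /sub_rVP.
apply: (@leq_ltn_trans (\rank (row 0 J))); last by rewrite rJ0.
apply/mxrankS/row_subP => i.
case: i => [[|[|//]] lt_i2].
  by rewrite (_ : Ordinal _ = 0) ?submx_refl //; apply: val_inj.
rewrite (_ : Ordinal _ = 1) ?J1 ?scalemx_sub ?submx_refl //.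
exact: val_inj.
Qed.

(** * Singular points as solutions of an eigenvalue problem *)

Section Criterion.
Variable k : fieldType.
Implicit Types (i : 'I_3) (v : 'I_(3 + 3) -> k).

Lemma mderivXX (i j : 'I_3) : (X k i)^`M(lshift 3 j) = (i == j)%:R.
Proof.
rewrite /X mderivX mnm1E eq_lshift; case: eqP => [->|_]; last first.
  by rewrite scale0r.
rewrite scale1r -mpolyX0; congr 'X_[_].
by apply/mnmP=> h; rewrite mnmBE mnm0E subnn.
Qed.

Lemma mderivYY (i j : 'I_3) : (Y k i)^`M(rshift 3 j) = (i == j)%:R.
Proof.
rewrite /Y mderivX mnm1E eq_rshift; case: eqP => [->|_]; last first.
  by rewrite scale0r.
rewrite scale1r -mpolyX0; congr 'X_[_].
by apply/mnmP=> h; rewrite mnmBE mnm0E subnn.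
Qed.

Lemma mderivXY (i j : 'I_3) : (X k i)^`M(rshift 3 j) = 0.
Proof. by rewrite /X mderivX mnm1E eq_lrshift scale0r. Qed.

Lemma mderivYX (i j : 'I_3) : (Y k i)^`M(lshift 3 j) = 0.
Proof. by rewrite /Y mderivX mnm1E eq_rlshift scale0r. Qed.

Lemma mevalX3 v i : (X k i).@[v] = v (lshift 3 i).
Proof. exact: mevalXU. Qed.

Lemma mevalY3 v i : (Y k i).@[v] = v (rshift 3 i).
Proof. exact: mevalXU. Qed.

Definition mderivE := (mderivD, mderivZ, mderivM,
  mderivXX, mderivYY, mderivXY, mderivYX).

Definition meval3E :=
  (mevalD, mevalZ, mevalM, meval0, meval1, mevalX3, mevalY3).

Lemma mderivGX v (j : 'I_3) : (G^`M(lshift 3 j)).@[v] = v (rshift 3 j).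
Proof.
rewrite /G sum_ord3; move: j; apply: ord3P; rewrite !mderivE !meval3E /=;
ring.
Qed.

Lemma mderivGY v (j : 'I_3) : (G^`M(rshift 3 j)).@[v] = v (lshift 3 j).
Proof.
rewrite /G sum_ord3; move: j; apply: ord3P; rewrite !mderivE !meval3E /=;
ring.
Qed.

(** The gradient of [G] at [v] is [v] with its X and Y blocks exchanged, hence nonzero at every
    point of projective space. The rank condition then makes the gradient of [F] a multiple of it,
    with factor [l]. *)
Lemma singular_GP (F : {mpoly k[3 + 3]}) :
  singular [tuple G; F] <->
  exists v (l : k), [/\ exists j : 'I_(3 + 3), v j != 0, G.@[v] = 0, F.@[v] = 0
    & forall i, F^`M(lshift 3 i).@[v] = l * v (rshift 3 i) /\
                F^`M(rshift 3 i).@[v] = l * v (lshift 3 i)].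
Proof.
have rowJ0 (w : 'rV[k]_(3 + 3)) j : row 0 (jacobian [tuple G; F] w) 0 j =
    G^`M(j).@[w 0] by rewrite !mxE.
have rowJ1 (w : 'rV[k]_(3 + 3)) j : row 1 (jacobian [tuple G; F] w) 0 j =
    F^`M(j).@[w 0] by rewrite !mxE.
have J0_neq0 (w : 'rV[k]_(3 + 3)) :
    w != 0 -> row 0 (jacobian [tuple G; F] w) != 0.
  apply: contraNneq => /rowP J0; apply/eqP/rowP => j; rewrite [RHS]mxE.
  rewrite -(splitK j); case: (split j) => i /=.
    by have := J0 (rshift 3 i); rewrite rowJ0 mderivGY mxE.
  by have := J0 (lshift 3 i); rewrite rowJ0 mderivGX mxE.
split=> [[w [w0 Fw /(rank_col_lt2 (J0_neq0 w w0)) [l /rowP Jl]]]|].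
  exists (w 0), l; split.
  - by move: w0 => /rV0Pn.
  - exact: (Fw 0).
  - exact: (Fw 1).
  - move=> i; split.
      by have := Jl (lshift 3 i); rewrite [RHS]mxE rowJ0 rowJ1 mderivGX.
    by have := Jl (rshift 3 i); rewrite [RHS]mxE rowJ0 rowJ1 mderivGY.
move=> [v [l [[j vj] Gv Fv dF]]]; pose w : 'rV[k]_(3 + 3) := \row_j v j.
have wv : w 0 =1 v by move=> h; rewrite mxE.
have w0 : w != 0 by apply/rV0Pn; exists j; rewrite wv.
exists w; split=> //.
  case=> [[|[|//]] lt_i2]; rewrite (tnth_nth 0) /= (meval_eq _ wv) //.
apply/(rank_col_lt2 (J0_neq0 w w0)); exists l; apply/rowP => h.
rewrite [RHS]mxE rowJ0 rowJ1 !(meval_eq _ wv) -(splitK h).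
case: (split h) => i /=; first by rewrite mderivGX; case: (dF i).
by rewrite mderivGY; case: (dF i).
Qed.

(** A common shape for the three families, so that the gradient is computed only once: [Q] and [Q1]
    are obtained by setting some of the [b]s to zero, [Q0] by taking [a] constant. *)
Definition quadric (a c d : 'I_3 -> k) (b1 b2 b3 b4 b5 b6 b7 b8 : k) :=
  Q1 a c d b1 b2 b3 b4
    + b5 *: (X k i1 * Y k i2) + b6 *: (X k i2 * Y k i1)
    + b7 *: (X k i1 * X k i2) + b8 *: (Y k i1 * Y k i2).

Hypothesis char2 : 2%N \in [pchar k].

(* Signs are immaterial in characteristic 2.  Those below are chosen so that
   the computations with al, be, ga, de below hold over the integers. *)
Lemma singular_quadricP (a c d : 'I_3 -> k) (b1 b2 b3 b4 b5 b6 b7 b8 : k) :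
  singular [tuple G; quadric a c d b1 b2 b3 b4 b5 b6 b7 b8] <->
  exists x y l,
  [/\ exists i, (x i != 0) || (y i != 0),
      x i1 * y i1 + x i2 * y i2 + x i3 * y i3 = 0,
      a i1 * (x i1 * y i1) + c i1 * x i1 ^+ 2 + d i1 * y i1 ^+ 2
      + (a i2 * (x i2 * y i2) + c i2 * x i2 ^+ 2 + d i2 * y i2 ^+ 2)
      + (a i3 * (x i3 * y i3) + c i3 * x i3 ^+ 2 + d i3 * y i3 ^+ 2)
      + b1 * (x i2 * y i3) + b2 * (x i3 * y i2)
      + b3 * (x i2 * x i3) + b4 * (y i2 * y i3)
      + b5 * (x i1 * y i2) + b6 * (x i2 * y i1)
      + b7 * (x i1 * x i2) + b8 * (y i1 * y i2) = 0
    & [/\ (a i1 - l) * x i1 = - (b6 * x i2 + b8 * y i2)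
           /\ (a i1 - l) * y i1 = - (b5 * y i2 + b7 * x i2),
         (a i2 - l) * x i2 = - (b2 * x i3 + b4 * y i3) - b5 * x i1 + b8 * y i1
           /\ (a i2 - l) * y i2
                = - (b1 * y i3 + b3 * x i3) + b7 * x i1 - b6 * y i1
       & (a i3 - l) * x i3 = b4 * y i2 - b1 * x i2
           /\ (a i3 - l) * y i3 = b3 * x i2 - b2 * y i2]].
Proof.
have two (u : k) : u + u = 0 by exact: addrr_pchar2.
(* Equations agreeing up to a double [e + e] are equivalent in characteristic 2. In the uses below,
   [e] collects the derivative of a square and the sign changes. *)
have iff_mod2 (u1 w1 u2 w2 e : k) :
    u1 - w1 = u2 - w2 + (e + e) -> u1 = w1 <-> u2 = w2.
  rewrite two addr0 => E; split=> /eqP; rewrite -subr_eq0; first rewrite E.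
    by rewrite subr_eq0 => /eqP.
  by rewrite -E subr_eq0 => /eqP.
rewrite singular_GP.
have GE v : G.@[v] = v (lshift 3 i1) * v (rshift 3 i1)
    + v (lshift 3 i2) * v (rshift 3 i2) + v (lshift 3 i3) * v (rshift 3 i3).
  by rewrite /G sum_ord3 !meval3E.
pose F := quadric a c d b1 b2 b3 b4 b5 b6 b7 b8.
have FE : F = quadric a c d b1 b2 b3 b4 b5 b6 b7 b8 by [].
have derP v l x y : (forall i, v (lshift 3 i) = x i) ->
    (forall i, v (rshift 3 i) = y i) ->
    (forall i, F^`M(lshift 3 i).@[v] = l * v (rshift 3 i) /\
               F^`M(rshift 3 i).@[v] = l * v (lshift 3 i)) <->
    [/\ (a i1 - l) * x i1 = - (b6 * x i2 + b8 * y i2)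
           /\ (a i1 - l) * y i1 = - (b5 * y i2 + b7 * x i2),
         (a i2 - l) * x i2 = - (b2 * x i3 + b4 * y i3) - b5 * x i1 + b8 * y i1
           /\ (a i2 - l) * y i2
                = - (b1 * y i3 + b3 * x i3) + b7 * x i1 - b6 * y i1
       & (a i3 - l) * x i3 = b4 * y i2 - b1 * x i2
           /\ (a i3 - l) * y i3 = b3 * x i2 - b2 * y i2].
  rewrite /quadric /Q1 /Q sum_ord3 in FE => vX vY.
  have X1 : F^`M(lshift 3 i1).@[v] = l * v (rshift 3 i1) <->
      (a i1 - l) * y i1 = - (b5 * y i2 + b7 * x i2).
    apply: (iff_mod2 _ _ _ _ (c i1 * x i1)).
    rewrite FE !(mderivD, mderivZ, mderivM).
    rewrite !(mderivXX, mderivYX, mderivYY, mderivXY).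
    rewrite !(mevalD, mevalZ, mevalM) !(meval0, meval1, mevalX3, mevalY3).
    by rewrite !vX !vY /=; ring.
  have X2 : F^`M(lshift 3 i2).@[v] = l * v (rshift 3 i2) <->
      (a i2 - l) * y i2 = - (b1 * y i3 + b3 * x i3) + b7 * x i1 - b6 * y i1.
    apply: (iff_mod2 _ _ _ _ (c i2 * x i2 + b7 * x i1)).
    rewrite FE !(mderivD, mderivZ, mderivM).
    rewrite !(mderivXX, mderivYX, mderivYY, mderivXY).
    rewrite !(mevalD, mevalZ, mevalM) !(meval0, meval1, mevalX3, mevalY3).
    by rewrite !vX !vY /=; ring.
  have X3 : F^`M(lshift 3 i3).@[v] = l * v (rshift 3 i3) <->
      (a i3 - l) * y i3 = b3 * x i2 - b2 * y i2.
    apply: (iff_mod2 _ _ _ _ (c i3 * x i3 + b3 * x i2)).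
    rewrite FE !(mderivD, mderivZ, mderivM).
    rewrite !(mderivXX, mderivYX, mderivYY, mderivXY).
    rewrite !(mevalD, mevalZ, mevalM) !(meval0, meval1, mevalX3, mevalY3).
    by rewrite !vX !vY /=; ring.
  (* The blocks cross over: deriving along Y_i yields the equation for [x i], and deriving along X_i
     the one for [y i]. *)
  have Y1 : F^`M(rshift 3 i1).@[v] = l * v (lshift 3 i1) <->
      (a i1 - l) * x i1 = - (b6 * x i2 + b8 * y i2).
    apply: (iff_mod2 _ _ _ _ (d i1 * y i1)).
    rewrite FE !(mderivD, mderivZ, mderivM).
    rewrite !(mderivXX, mderivYX, mderivYY, mderivXY).
    rewrite !(mevalD, mevalZ, mevalM) !(meval0, meval1, mevalX3, mevalY3).
    by rewrite !vX !vY /=; ring.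
  have Y2 : F^`M(rshift 3 i2).@[v] = l * v (lshift 3 i2) <->
      (a i2 - l) * x i2 = - (b2 * x i3 + b4 * y i3) - b5 * x i1 + b8 * y i1.
    apply: (iff_mod2 _ _ _ _ (d i2 * y i2 + b8 * y i1)).
    rewrite FE !(mderivD, mderivZ, mderivM).
    rewrite !(mderivXX, mderivYX, mderivYY, mderivXY).
    rewrite !(mevalD, mevalZ, mevalM) !(meval0, meval1, mevalX3, mevalY3).
    by rewrite !vX !vY /=; ring.
  have Y3 : F^`M(rshift 3 i3).@[v] = l * v (lshift 3 i3) <->
      (a i3 - l) * x i3 = b4 * y i2 - b1 * x i2.
    apply: (iff_mod2 _ _ _ _ (d i3 * y i3 + b4 * y i2)).
    rewrite FE !(mderivD, mderivZ, mderivM).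
    rewrite !(mderivXX, mderivYX, mderivYY, mderivXY).
    rewrite !(mevalD, mevalZ, mevalM) !(meval0, meval1, mevalX3, mevalY3).
    by rewrite !vX !vY /=; ring.
  split=> [dF|[[/Y1 Y1' /X1 X1'] [/Y2 Y2' /X2 X2'] [/Y3 Y3' /X3 X3']]].
    case: (dF i1) (dF i2) (dF i3) => dX1 dY1 [dX2 dY2] [dX3 dY3].
    by split; split; [apply/Y1|apply/X1|apply/Y2|apply/X2|apply/Y3|apply/X3].
  exact: ord3P.
split=> [[v [l [[j vj] Gv Fv dF]]]|[x [y [l [[i xyi] Gxy Fxy dF]]]]].
  exists (fun i => v (lshift 3 i)), (fun i => v (rshift 3 i)), l; split=> //.
  - move: vj; rewrite -(splitK j); case: (split j) => i /= vi; exists i.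
      by rewrite vi.
    by rewrite vi orbT.
  - by rewrite -GE.
  - by rewrite -[RHS]Fv /quadric /Q1 /Q sum_ord3 !meval3E !expr2.
  - exact/(derP v l _ _ (fun=> erefl) (fun=> erefl)).
pose v (j : 'I_(3 + 3)) := match split j with inl i => x i | inr i => y i end.
have vX i' : v (lshift 3 i') = x i'.
  by rewrite /v -[lshift _ _]/(unsplit (inl _)) unsplitK.
have vY i' : v (rshift 3 i') = y i'.
  by rewrite /v -[rshift _ _]/(unsplit (inr _)) unsplitK.
exists v, l; split.
- case/orP: xyi => [xi|yi]; first by exists (lshift 3 i); rewrite vX.
  by exists (rshift 3 i); rewrite vY.
- by rewrite GE !vX !vY.
- by rewrite -[RHS]Fxy /quadric /Q1 /Q sum_ord3 !meval3E !vX !vY !expr2.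
- exact/(derP v l x y vX vY).
Qed.

End Criterion.

(** * Common zeros of two forms in the squares of two variables *)

Lemma exists_sqrt (k : closedFieldType) (a : k) : exists s, s ^+ 2 = a.
Proof.
(* The coefficients encode the monic equation s^2 = a + 0 s. *)
have [s] := solve_monicpoly (fun i => if i is 0%N then a else 0) (ltn0Sn 1).
by move=> sE; exists s; rewrite sE !big_ord_recr big_ord0 /=; ring.
Qed.

(** In S = s^2 and T = t^2 this is a homogeneous linear system with determinant [A * D + B * C].
    Square roots exist in [k], so every nonzero (S, T) comes from a nonzero (s, t). *)
Lemma pencil_sqr_zero (k : closedFieldType) (A B C D : k) :
  (exists s t, [/\ (s != 0) || (t != 0), A * s ^+ 2 = B * t ^+ 2
                 & C * s ^+ 2 + D * t ^+ 2 = 0]) <-> A * D + B * C = 0.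
Proof.
split=> [[s [t [st0 ABst CDst]]]|det0].
  case/orP: st0 => [s0|t0].
    (* Eliminating t: (A D + B C) s^2 = B (C s^2 + D t^2). *)
    apply: (mulIf (expf_neq0 2 s0)).
    rewrite mul0r -(mulr0 B) -CDst mulrDl mulrAC ABst; ring.
  apply: (mulIf (expf_neq0 2 t0)); rewrite mul0r -(mulr0 A) -CDst.
  rewrite mulrDl [B * C * _]mulrAC -ABst; ring.
have sol S T : (S != 0) || (T != 0) -> A * S = B * T -> C * S + D * T = 0 ->
    exists s t, [/\ (s != 0) || (t != 0), A * s ^+ 2 = B * t ^+ 2
                 & C * s ^+ 2 + D * t ^+ 2 = 0].
  have [s <-] := exists_sqrt S; have [t <-] := exists_sqrt T => ST AB CD.
  by exists s, t; rewrite !expf_eq0 /= in ST.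
(* If (B, A) is nonzero it solves the first equation, and the second one becomes the vanishing of
   the determinant. *)
have [/norP[A0 B0]|] := boolP (~~ ((A != 0) || (B != 0))); last first.
  rewrite negbK => AB0; apply: (sol B A); first by rewrite orbC.
    by rewrite mulrC.
  by rewrite -[RHS]det0; ring.
move: A0 B0; rewrite !negbK => /eqP A0 /eqP B0; subst A B.
(* Only the second equation is left; (D, -C) solves it unless C = D = 0, when any point will do. *)
have [/norP[C0 D0]|] := boolP (~~ ((C != 0) || (D != 0))); last first.
  rewrite negbK => CD0; apply: (sol D (- C)); first by rewrite oppr_eq0 orbC.
    by rewrite !mul0r.
  by ring.
move: C0 D0; rewrite !negbK => /eqP C0 /eqP D0; subst C D.
by apply: (sol 1 0); rewrite ?oner_eq0 // !mul0r ?addr0.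
Qed.

(** * The coordinates p = ga x - al y and q = de x + be y *)

Lemma frame_eq0 (k : fieldType) (al be ga de x y : k) :
  al * de + be * ga = 1 -> ga * x - al * y = 0 -> de * x + be * y = 0 ->
  x = 0 /\ y = 0.
Proof.
move=> ad p0 q0; rewrite -[x]mul1r -[y]mul1r -ad; split.
  rewrite (_ : _ * x = be * (ga * x - al * y) + al * (de * x + be * y));
    last ring.
  by rewrite p0 q0 !mulr0 addr0.
rewrite (_ : _ * y = ga * (de * x + be * y) - de * (ga * x - al * y));
  last ring.
by rewrite p0 q0 !mulr0 subr0.
Qed.

(** The change of coordinates has determinant 1, with inverse x = be p + al q, y = ga q - de p. The
    parameter s is q. *)
Lemma frame_p_eq0 (k : fieldType) (al be ga de x y : k) :
  al * de + be * ga = 1 -> ga * x - al * y = 0 ->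
  exists s, x = s * al /\ y = s * ga.
Proof.
move=> ad p0; exists (de * x + be * y); split.
  transitivity (1 * x - be * (ga * x - al * y)); first by rewrite p0; ring.
  by rewrite -ad; ring.
transitivity (1 * y + de * (ga * x - al * y)); first by rewrite p0; ring.
by rewrite -ad; ring.
Qed.

(** By the same inverse formulas, with p as the parameter t. *)
Lemma frame_q_eq0 (k : fieldType) (al be ga de x y : k) :
  al * de + be * ga = 1 -> de * x + be * y = 0 ->
  exists t, x = t * be /\ y = - (t * de).
Proof.
move=> ad q0; exists (ga * x - al * y); split.
  transitivity (1 * x - al * (de * x + be * y)); first by rewrite q0; ring.
  by rewrite -ad; ring.
transitivity (1 * y - ga * (de * x + be * y)); first by rewrite q0; ring.
by rewrite -ad; ring.
Qed.

(** Exactly one of x, y vanishes, and the square of the other kills its own coefficient. *)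
Lemma axis_point (k : fieldType) (c d x y : k) :
  (x != 0) || (y != 0) -> x * y = 0 -> c * x ^+ 2 + d * y ^+ 2 = 0 -> c * d = 0.
Proof.
move=> xy0 /eqP; rewrite mulf_eq0 => /orP[] /eqP xy;
  move: xy0; rewrite xy eqxx /=.
  move=> y0; rewrite expr0n mulr0 add0r => /eqP.
  by rewrite mulf_eq0 sqrf_eq0 (negPf y0) orbF => /eqP ->; rewrite mulr0.
rewrite orbF => x0; rewrite expr0n mulr0 addr0 => /eqP.
by rewrite mulf_eq0 sqrf_eq0 (negPf x0) orbF => /eqP ->; rewrite mul0r.
Qed.

Definition vec3 (k : fieldType) (u v w : k) (i : 'I_3) := nth 0 [:: u; v; w] i.

(** Determinant 1 forces (al, ga) and (be', de') to be nonzero pairs. This ensures that the points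
    built from (s, t) have a nonzero coordinate. *)
Lemma frame_neq0 (k : fieldType) (al be ga de al' be' ga' de' s t : k) :
  al * de + be * ga = 1 -> al' * de' + be' * ga' = 1 -> (s != 0) || (t != 0) ->
  [|| s * al != 0, s * ga != 0, t * be' != 0 | - (t * de') != 0].
Proof.
move=> ad ad'; rewrite oppr_eq0 !mulf_eq0 !negb_or.
case: (eqVneq s 0) => [_ /= t0|_ _] /=.
  rewrite t0 /=; apply: contraT; rewrite negb_or !negbK.
  move=> /andP[/eqP b0 /eqP d0].
  by move/eqP: ad'; rewrite b0 d0 mulr0 mul0r addr0 eq_sym oner_eq0.
apply: contraT; rewrite !negb_or !negbK => /and3P[/eqP a0 /eqP g0 _].
by move/eqP: ad; rewrite a0 g0 mulr0 mul0r addr0 eq_sym oner_eq0.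
Qed.

Lemma quadric_Q (k : fieldType) (a c d : 'I_3 -> k) :
  Q a c d = quadric a c d 0 0 0 0 0 0 0 0.
Proof. by rewrite /quadric /Q1 !scale0r !addr0. Qed.

Lemma quadric_Q1 (k : fieldType) (a c d : 'I_3 -> k) b1 b2 b3 b4 :
  Q1 a c d b1 b2 b3 b4 = quadric a c d b1 b2 b3 b4 0 0 0 0.
Proof. by rewrite /quadric !scale0r !addr0. Qed.

(** * The three normal forms *)

Section Pencils.
Variables (k : closedFieldType) (char2 : 2%N \in [pchar k]).
Implicit Types (a c d al be ga de : 'I_3 -> k).

Lemma singular_Q a c d : injective a ->
  singular [tuple G; Q a c d] <-> \prod_(i < 3) (c i * d i) = 0.
Proof.
move=> a_inj; rewrite quadric_Q singular_quadricP //; split.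
  move=> [x [y [l [[i xyi] Gxy Qxy [[X1 Y1] [X2 Y2] [X3 Y3]]]]]].
  have eigen : forall j, (a j - l) * x j = 0 /\ (a j - l) * y j = 0.
    apply: ord3P; split; rewrite ?X1 ?X2 ?X3 ?Y1 ?Y2 ?Y3; ring.
  have al : a i = l.
    have [/eqP xi /eqP yi] := eigen i; apply/eqP; rewrite -subr_eq0.
    by move: xi yi; rewrite !mulf_eq0; case: eqP => //= _ /eqP xi /eqP yi;
      rewrite xi yi eqxx in xyi.
  have off j : j != i -> x j = 0 /\ y j = 0.
    rewrite -(inj_eq a_inj) al -subr_eq0 => aj; have [xj yj] := eigen j.
    by split; apply: (mulfI aj); rewrite mulr0.
  have Gi : x i * y i = 0.
    rewrite -[RHS]Gxy -(sum_ord3 (fun j => x j * y j)) (bigD1 i) //=.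
    rewrite big1 ?addr0 //.
    by move=> j /off[-> _]; rewrite mul0r.
  have Qi : c i * x i ^+ 2 + d i * y i ^+ 2 = 0.
    rewrite -[RHS]Qxy !mul0r !addr0.
    rewrite -(sum_ord3
      (fun j => a j * (x j * y j) + c j * x j ^+ 2 + d j * y j ^+ 2)).
    rewrite (bigD1 i) //= big1 ?Gi ?mulr0 ?add0r ?addr0 //.
    by move=> j /off[-> ->]; rewrite expr0n !mulr0 !addr0.
  by apply/eqP/prodf_eq0; exists i => //; apply/eqP/(axis_point xyi).
(* The singular point is the coordinate point whose square has coefficient zero, with eigenvalue
   [a i]. *)
move=> /eqP /prodf_eq0[i _]; rewrite mulf_eq0 => /orP[] /eqP cd0.
  exists (fun j => (j == i)%:R), (fun=> 0), (a i); split.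
  - by exists i; rewrite /= eqxx oner_eq0.
  - by rewrite !mulr0 !addr0.
  - rewrite !mul0r !mulr0 expr0n !mulr0 !addr0 !add0r.
    rewrite -(sum_ord3 (fun j => c j * (j == i)%:R ^+ 2)) big1 // => j _.
    by case: eqP => [->|_]; rewrite ?cd0 ?mul0r // expr0n mulr0.
  - have eigen j : (a j - a i) * (j == i)%:R = 0.
      by case: eqP => [->|_]; rewrite ?subrr ?mul0r ?mulr0.
    by rewrite !eigen; do !split; ring.
exists (fun=> 0), (fun j => (j == i)%:R), (a i); split.
- by exists i; rewrite /= !eqxx oner_eq0.
- by rewrite !mul0r !addr0.
- rewrite !mul0r !mulr0 expr0n !mulr0 !addr0 !add0r.
  rewrite -(sum_ord3 (fun j => d j * (j == i)%:R ^+ 2)) big1 // => j _.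
  by case: eqP => [->|_]; rewrite ?cd0 ?mul0r // expr0n mulr0.
- have eigen j : (a j - a i) * (j == i)%:R = 0.
    by case: eqP => [->|_]; rewrite ?subrr ?mul0r ?mulr0.
  by rewrite !eigen; do !split; ring.
Qed.

Lemma singular_Q1 a c d al be ga de (b1 b2 b3 b4 : k) :
  a i1 <> a i2 -> a i2 = a i3 ->
  (forall i, al i * de i + be i * ga i = 1) ->
  b1 = be i3 * ga i2 -> b2 = al i2 * de i3 ->
  b3 = ga i2 * de i3 -> b4 = al i2 * be i3 ->
  singular [tuple G; Q1 a c d b1 b2 b3 b4] <->
    c i1 * d i1 = 0 \/
    b2 * b4 * c i2 + b1 * b4 * c i3 + b1 * b3 * d i2 + b2 * b3 * d i3 = 0.
Proof.
move=> a12 a23 ad -> -> -> ->; rewrite quadric_Q1 singular_quadricP //.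
set f := (X in _ \/ X = 0).
(* The determinant A D + B C of the system in s^2 and t^2: A and B come from [G], C and D from the
   squares in the second quadric. *)
have fE : f = al i2 * ga i2 * (c i3 * be i3 ^+ 2 + d i3 * de i3 ^+ 2)
            + be i3 * de i3 * (c i2 * al i2 ^+ 2 + d i2 * ga i2 ^+ 2).
  by rewrite /f; ring.
rewrite fE -pencil_sqr_zero -a23 {fE}; split.
  move=> [x [y [l [[i xyi] Gxy Qxy [[X1 Y1] [X2 Y2] [X3 Y3]]]]]].
  rewrite !mul0r !(oppr0, addr0) in X1 Y1 X2 Y2.
  have mp2 : (a i2 - l) * (ga i2 * x i2 - al i2 * y i2) = 0.
    by rewrite mulrBr ![(a i2 - l) * (_ * _)]mulrCA X2 Y2; ring.
  have mq2 : (a i2 - l) * (de i2 * x i2 + be i2 * y i2)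
             = - (de i3 * x i3 + be i3 * y i3).
    (* Multiplying the right side by al de + be ga = 1 turns the claim into a polynomial
       identity. *)
    rewrite -[RHS]mulr1 -(ad i2) mulrDr ![(a i2 - l) * (_ * _)]mulrCA X2 Y2.
    by ring.
  have mp3 : (a i2 - l) * (ga i3 * x i3 - al i3 * y i3)
             = - (ga i2 * x i2 - al i2 * y i2).
    rewrite -[RHS]mulr1 -(ad i3) mulrBr ![(a i2 - l) * (_ * _)]mulrCA X3 Y3.
    by ring.
  have mq3 : (a i2 - l) * (de i3 * x i3 + be i3 * y i3) = 0.
    by rewrite mulrDr ![(a i2 - l) * (_ * _)]mulrCA X3 Y3; ring.
  have [/eqP|m_neq0] := eqVneq (a i2 - l) 0.
    rewrite subr_eq0 => /eqP la; rewrite -la in X1 Y1 mq2 mp3.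
    have m1_neq0 : a i1 - a i2 != 0 by rewrite subr_eq0; apply/eqP.
    have x1 : x i1 = 0 by apply: (mulfI m1_neq0); rewrite X1 mulr0.
    have y1 : y i1 = 0 by apply: (mulfI m1_neq0); rewrite Y1 mulr0.
    move: mp3 mq2; rewrite subrr !mul0r => /esym/eqP + /esym/eqP.
    rewrite !oppr_eq0 => /eqP/(frame_p_eq0 (ad i2))[s [x2 y2]].
    move=> /eqP/(frame_q_eq0 (ad i3))[t [x3 y3]].
    right; exists s, t; split.
    - move: i xyi; apply: ord3P; rewrite ?x1 ?y1 ?x2 ?y2 ?x3 ?y3 ?eqxx //;
      by rewrite ?oppr_eq0 !mulf_eq0 !negb_or =>
        /orP[]/andP[-> _] //; rewrite orbT.
    - apply/eqP; rewrite -subr_eq0; apply/eqP; rewrite -[RHS]Gxy.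
      by rewrite x1 y1 x2 y2 x3 y3; ring.
    (* On these points the mixed terms with [b1] to [b4] cancel, so the second quadric is C s^2 + D
       t^2 plus [a i2] times [G]. *)
    - rewrite -[RHS]Qxy -[LHS]addr0 -[X in _ + X](mulr0 (a i2)) -Gxy.
      by rewrite x1 y1 x2 y2 x3 y3; ring.
  (* For l different from [a i2], p_2 = 0 gives p_3 = 0 and q_3 = 0 gives q_2 = 0, leaving only the
     pair (x_1, y_1). *)
  have cancel u : (a i2 - l) * u = 0 -> u = 0.
    by move=> mu0; apply: (mulfI m_neq0); rewrite mu0 mulr0.
  have p2 := cancel _ mp2; have q3 := cancel _ mq3.
  rewrite p2 oppr0 in mp3; rewrite q3 oppr0 in mq2.
  have [x2 y2] := frame_eq0 (ad i2) p2 (cancel _ mq2).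
  have [x3 y3] := frame_eq0 (ad i3) (cancel _ mp3) q3.
  have xy1 : x i1 * y i1 = 0 by rewrite -[RHS]Gxy x2 x3; ring.
  left; apply: (@axis_point _ _ _ (x i1) (y i1)) => //.
    by move: i xyi; apply: ord3P; rewrite // ?x2 ?x3 ?y2 ?y3 eqxx.
  rewrite -[RHS]Qxy xy1 x2 x3 y2 y3; ring.
case=> [cd0|[s [t [st0 AB CD]]]].
  move/eqP: cd0; rewrite mulf_eq0 => /orP[] /eqP cd0.
    exists (vec3 1 0 0), (vec3 0 0 0), (a i1); rewrite /vec3; split=> /=.
    - by exists i1; rewrite oner_eq0.
    - by ring.
    - by rewrite cd0; ring.
    - by do !split; ring.
  exists (vec3 0 0 0), (vec3 1 0 0), (a i1); rewrite /vec3; split=> /=.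
  - by exists i1; rewrite eqxx oner_eq0.
  - by ring.
  - by rewrite cd0; ring.
  - by do !split; ring.
(* The point with q_2 = s, p_3 = t and p_2 = q_3 = 0, lying in the eigenspace of [a i2]. *)
exists (vec3 0 (s * al i2) (t * be i3)),
  (vec3 0 (s * ga i2) (- (t * de i3))), (a i2).
rewrite /vec3; split=> /=.
- have /or4P[] := frame_neq0 (ad i2) (ad i3) st0 => neq0.
  + by exists i2; rewrite neq0.
  + by exists i2; rewrite neq0 orbT.
  + by exists i3; rewrite neq0.
  + by exists i3; rewrite neq0 orbT.
- transitivity (al i2 * ga i2 * s ^+ 2 - be i3 * de i3 * t ^+ 2); first by ring.
  by rewrite AB subrr.
- rewrite -[RHS]CD -[RHS]addr0 -[X in _ = _ + X](mulr0 (a i2)).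
  rewrite -[X in _ = _ + _ * X](subrr (be i3 * de i3 * t ^+ 2)) -{1}AB.
  by ring.
- by do !split; ring.
Qed.

Lemma singular_Q0 (a : k) c d al be ga de (b1 b2 b3 b4 b5 b6 b7 b8 : k) :
  (forall i, al i * de i + be i * ga i = 1) ->
  b1 = be i3 * ga i2 -> b2 = al i2 * de i3 ->
  b3 = ga i2 * de i3 -> b4 = al i2 * be i3 ->
  b5 = be i2 * ga i1 -> b6 = al i1 * de i2 ->
  b7 = ga i1 * de i2 -> b8 = al i1 * be i2 ->
  singular [tuple G; Q0 a c d b1 b2 b3 b4 b5 b6 b7 b8] <->
    c i1 * (b1 * b8 + b4 * b6) * (b2 * b6 + b3 * b8)
    + c i3 * (b1 * b5 + b4 * b7) * (b1 * b8 + b4 * b6)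
    + d i1 * (b1 * b5 + b4 * b7) * (b2 * b7 + b3 * b5)
    + d i3 * (b2 * b6 + b3 * b8) * (b2 * b7 + b3 * b5) = 0.
Proof.
move=> ad -> -> -> -> -> -> -> ->.
rewrite -[Q0 _ _ _ _ _ _ _ _ _ _ _]/(quadric _ _ _ _ _ _ _ _ _ _ _).
rewrite singular_quadricP //.
(* Each two-term factor of the criterion contains al de + be ga at index 2, so it collapses to a
   product of constants of indices 1 and 3. *)
have u18 : be i3 * ga i2 * (al i1 * be i2) + al i2 * be i3 * (al i1 * de i2)
    = al i1 * be i3 by rewrite -[RHS]mulr1 -(ad i2); ring.
have u26 : al i2 * de i3 * (al i1 * de i2) + ga i2 * de i3 * (al i1 * be i2)
    = al i1 * de i3 by rewrite -[RHS]mulr1 -(ad i2); ring.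
have u15 : be i3 * ga i2 * (be i2 * ga i1) + al i2 * be i3 * (ga i1 * de i2)
    = be i3 * ga i1 by rewrite -[RHS]mulr1 -(ad i2); ring.
have u27 : al i2 * de i3 * (ga i1 * de i2) + ga i2 * de i3 * (be i2 * ga i1)
    = ga i1 * de i3 by rewrite -[RHS]mulr1 -(ad i2); ring.
rewrite {}u18 {}u26 {}u15 {}u27.
set f := (X in _ <-> X = 0).
have {f}-> : f = al i1 * ga i1 * (c i3 * be i3 ^+ 2 + d i3 * de i3 ^+ 2)
            + be i3 * de i3 * (c i1 * al i1 ^+ 2 + d i1 * ga i1 ^+ 2).
  by rewrite /f; ring.
rewrite -pencil_sqr_zero; split.
  move=> [x [y [l [[i xyi] Gxy Qxy /=]]]].
  have [m ->] : exists m, a - l = m by exists (a - l).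
  move=> [[X1 Y1] [X2 Y2] [X3 Y3]].
  have mp1 : m * (ga i1 * x i1 - al i1 * y i1) = 0.
    by rewrite mulrBr ![m * (_ * _)]mulrCA X1 Y1; ring.
  have mq1 : m * (de i1 * x i1 + be i1 * y i1)
             = - (de i2 * x i2 + be i2 * y i2).
    by rewrite -[RHS]mulr1 -(ad i1) mulrDr ![m * (_ * _)]mulrCA X1 Y1; ring.
  have mp2 : m * (ga i2 * x i2 - al i2 * y i2)
             = - (ga i1 * x i1 - al i1 * y i1).
    by rewrite -[RHS]mulr1 -(ad i2) mulrBr ![m * (_ * _)]mulrCA X2 Y2; ring.
  have mq2 : m * (de i2 * x i2 + be i2 * y i2)
             = - (de i3 * x i3 + be i3 * y i3).
    by rewrite -[RHS]mulr1 -(ad i2) mulrDr ![m * (_ * _)]mulrCA X2 Y2; ring.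
  have mp3 : m * (ga i3 * x i3 - al i3 * y i3)
             = - (ga i2 * x i2 - al i2 * y i2).
    by rewrite -[RHS]mulr1 -(ad i3) mulrBr ![m * (_ * _)]mulrCA X3 Y3; ring.
  have mq3 : m * (de i3 * x i3 + be i3 * y i3) = 0.
    by rewrite mulrDr ![m * (_ * _)]mulrCA X3 Y3; ring.
  (* If m = 0, the shifted equations kill p_1, p_2, q_2 and q_3. Otherwise everything vanishes
     successively, p from index 1 upwards and q from index 3 downwards, which is impossible. *)
  have [m0|m_neq0] := eqVneq m 0.
    have opp0 (u v : k) : m * u = - v -> v = 0.
      by rewrite m0 mul0r => /esym/eqP; rewrite oppr_eq0 => /eqP.
    have [x2 y2] := frame_eq0 (ad i2) (opp0 _ _ mp3) (opp0 _ _ mq1).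
    have [s [x1 y1]] := frame_p_eq0 (ad i1) (opp0 _ _ mp2).
    have [t [x3 y3]] := frame_q_eq0 (ad i3) (opp0 _ _ mq2).
    exists s, t; split.
    - move: i xyi; apply: ord3P; rewrite ?x1 ?y1 ?x2 ?y2 ?x3 ?y3 ?eqxx //;
      by rewrite ?oppr_eq0 !mulf_eq0 !negb_or =>
        /orP[]/andP[-> _] //; rewrite orbT.
    - apply/eqP; rewrite -subr_eq0; apply/eqP; rewrite -[RHS]Gxy.
      by rewrite x1 y1 x2 y2 x3 y3; ring.
    - rewrite -[RHS]Qxy -[LHS]addr0 -[X in _ + X](mulr0 a) -Gxy.
      by rewrite x1 y1 x2 y2 x3 y3; ring.
  have cancel u : m * u = 0 -> u = 0.
    by move=> mu0; apply: (mulfI m_neq0); rewrite mu0 mulr0.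
  have p1 := cancel _ mp1; rewrite p1 oppr0 in mp2.
  have p2 := cancel _ mp2; rewrite p2 oppr0 in mp3.
  have q3 := cancel _ mq3; rewrite q3 oppr0 in mq2.
  have q2 := cancel _ mq2; rewrite q2 oppr0 in mq1.
  have [x1 y1] := frame_eq0 (ad i1) p1 (cancel _ mq1).
  have [x2 y2] := frame_eq0 (ad i2) p2 q2.
  have [x3 y3] := frame_eq0 (ad i3) (cancel _ mp3) q3.
  by move: i xyi; apply: ord3P; rewrite ?x1 ?y1 ?x2 ?y2 ?x3 ?y3 eqxx.
move=> [s [t [st0 AB CD]]].
(* The point with q_1 = s, p_3 = t and all other p_i, q_i zero. *)
exists (vec3 (s * al i1) 0 (t * be i3)),
  (vec3 (s * ga i1) 0 (- (t * de i3))), a.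
rewrite /vec3; split=> /=.
- have /or4P[] := frame_neq0 (ad i1) (ad i3) st0 => neq0.
  + by exists i1; rewrite neq0.
  + by exists i1; rewrite neq0 orbT.
  + by exists i3; rewrite neq0.
  + by exists i3; rewrite neq0 orbT.
- transitivity (al i1 * ga i1 * s ^+ 2 - be i3 * de i3 * t ^+ 2); first by ring.
  by rewrite AB subrr.
- rewrite -[RHS]CD -[RHS]addr0 -[X in _ = _ + X](mulr0 a).
  rewrite -[X in _ = _ + _ * X](subrr (be i3 * de i3 * t ^+ 2)) -{1}AB.
  by ring.
- by do !split; ring.
Qed.

End Pencils.

Theorem lemma3p1 (k : closedFieldType) (char2 : 2%N \in [pchar k]) :
  [/\
   (* (a) *)
   forall a c d : 'I_3 -> k,
     injective a ->
     singular [tuple G; Q a c d] <-> \prod_(i < 3) (c i * d i) = 0,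
   (* (b) *)
   forall (a c d al be ga de : 'I_3 -> k) (b1 b2 b3 b4 : k),
     a i1 <> a i2 -> a i2 = a i3 ->
     (forall i, al i * de i + be i * ga i = 1) ->
     b1 = be i3 * ga i2 -> b2 = al i2 * de i3 ->
     b3 = ga i2 * de i3 -> b4 = al i2 * be i3 ->
     singular [tuple G; Q1 a c d b1 b2 b3 b4] <->
       c i1 * d i1 = 0 \/
       b2 * b4 * c i2 + b1 * b4 * c i3 + b1 * b3 * d i2 + b2 * b3 * d i3 = 0
   & (* (c) *)
   forall (a : k) (c d al be ga de : 'I_3 -> k)
          (b1 b2 b3 b4 b5 b6 b7 b8 : k),
     (forall i, al i * de i + be i * ga i = 1) ->
     b1 = be i3 * ga i2 -> b2 = al i2 * de i3 ->
     b3 = ga i2 * de i3 -> b4 = al i2 * be i3 ->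
     b5 = be i2 * ga i1 -> b6 = al i1 * de i2 ->
     b7 = ga i1 * de i2 -> b8 = al i1 * be i2 ->
     singular [tuple G; Q0 a c d b1 b2 b3 b4 b5 b6 b7 b8] <->
       c i1 * (b1 * b8 + b4 * b6) * (b2 * b6 + b3 * b8)
       + c i3 * (b1 * b5 + b4 * b7) * (b1 * b8 + b4 * b6)
       + d i1 * (b1 * b5 + b4 * b7) * (b2 * b7 + b3 * b5)
       + d i3 * (b2 * b6 + b3 * b8) * (b2 * b7 + b3 * b5) = 0].
Proof.
split.
- by move=> a c d; apply: singular_Q.
- by move=> a c d al be ga de b1 b2 b3 b4; apply: singular_Q1.
- by move=> a c d al be ga de b1 b2 b3 b4 b5 b6 b7 b8; apply: singular_Q0.
Qed.
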